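(* Let $d\in\mathbb N$, $a\in\mathbb R$, $b\in[a,\infty)$, let $\mu\colon\mathcal B([a,b]^d)\to[0,\infty]$ be a measure, let $f\colon[a,b]^d\to\mathbb R$ be bounded and measurable, let $k\in\mathbb N$, $c\in(0,\infty]$, let $\sigma\colon\mathbb R\to\mathbb R$ satisfy $\sigma(x)=(\max\{\min\{x,c\},0\})^k$ for all $x\in\mathbb R$, and let $D_h$, $\mathcal L_h\colon\mathbb R^{D_h}\to\mathbb R$ (assumed real-valued), $\mathbb I_h$ ($h\in\mathbb N_0$) and $\mathscr K\in\mathbb N_0\cup\{\infty\}$ be as defined in the context. Let $H,n\in\mathbb N_0$ satisfy $n=\min\{H,\mathscr K\}$, and assume for all $h\in\{0,1,\dots,n\}$ that there exists $\theta_h\in\mathbb R^{D_h}$ such that $\mathcal L_h(\theta_h)=\mathbb I_h$. Then there exist $\vartheta_0,\vartheta_1,\dots,\vartheta_n\in\mathbb R^{D_H}$ such that (i) for all $h\in\{0,1,\dots,n\}$, $\vartheta_h$ is a local minimum of $\mathcal L_H$, and (ii) $$\inf_{\xi\in\mathbb R}\int_{[a,b]^d}|f(x)-\xi|^2\,\mu(dx)\ge\mathcal L_H(\vartheta_0)>\mathcal L_H(\vartheta_1)>\dots>\mathcal L_H(\vartheta_n).$$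
   Context: For $h\in\mathbb N_0$ let $D_h=dh+2h+1$; for $\theta\in\mathbb R^{D_h}$, $x\in\mathbb R^d$ let $$\mathcal N_h^\theta(x)=\theta_{dh+2h+1}+\sum_{i=1}^h\theta_{dh+h+i}\,\sigma\Bigl(\theta_{dh+i}+\sum_{j=1}^d\theta_{(i-1)d+j}x_j\Bigr);$$ $\mathcal L_h(\theta)=\int_{[a,b]^d}(\mathcal N_h^\theta(x)-f(x))^2\,\mu(dx)$, where $\mathcal L_h\colon\mathbb R^{D_h}\to\mathbb R$ is assumed real-valued for every $h\in\mathbb N_0$ (so $\mu$ is finite); $\mathbb I_h=\inf_{\theta\in\mathbb R^{D_h}}\mathcal L_h(\theta)$; $\mathscr K=\inf(\{h\in\mathbb N_0\colon\mathbb I_h=0\}\cup\{\infty\})$. *)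

(* Defs.v *)
From HB Require Import structures.
From mathcomp Require Import all_boot all_order all_algebra.
From mathcomp Require Import all_classical all_reals all_analysis.

Set Implicit Arguments.
Unset Strict Implicit.
Unset Printing Implicit Defensive.

Import Order.TTheory GRing.Theory Num.Theory.
Import numFieldNormedType.Exports.

Local Open Scope classical_set_scope.
Local Open Scope ring_scope.

Definition cube (R : realType) (d : nat) (a b : R) : set 'rV[R]_d :=
  [set x | forall j : 'I_d, a <= x 0 j <= b].

Arguments cube {R} d a b _.

Lemma cube_const (R : realType) (d : nat) (a b : R) (hab : a <= b) :
  (const_mx a : 'rV[R]_d) \in cube d a b.
Proof. by rewrite inE => j; rewrite mxE lexx. Qed.

(* [a, b]^d as a type of its own, with the topology induced by R^d. The proof
   of [a <= b] provides the point that the library requires of every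
   measurable space. *)
Definition cube_type (R : realType) (d : nat) (a b : R) (hab : a <= b) : Type :=
  set_type (cube d a b).

Section cube_type_instances.
Context (R : realType) (d : nat) (a b : R) (hab : a <= b).

HB.instance Definition _ :=
  Topological.copy (cube_type d hab) (set_type (cube d a b)).

HB.instance Definition _ :=
  isPointed.Build (cube_type d hab) (SigSub (cube_const d hab)).

End cube_type_instances.

(* [a, b]^d with its Borel sigma-algebra. *)
Definition borel_cube (R : realType) (d : nat) (a b : R) (hab : a <= b) :=
  g_sigma_algebraType (@open (cube_type d hab)).

Definition cube_val (R : realType) (d : nat) (a b : R) (hab : a <= b)
  (x : borel_cube d hab) : 'rV[R]_d := \val (x : set_type (cube d a b)).

(* D_h = d h + 2 h + 1, written as a successor so that [inord] applies. *)
Definition nparam (d h : nat) : nat := (d * h + 2 * h).+1.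

(* Zero-based coordinates: [coord_at theta m] is theta_{m+1}. Only indices
   [m < nparam d h] are used below, where [inord] is exact. *)
Definition coord_at (R : realType) (d h : nat)
  (theta : 'rV[R]_(nparam d h)) (m : nat) : R := theta 0 (inord m).

Definition network (R : realType) (sigma : R -> R) (d h : nat)
    (theta : 'rV[R]_(nparam d h)) (x : 'rV[R]_d) : R :=
  coord_at theta (d * h + 2 * h) +
  \sum_(i < h) coord_at theta (d * h + h + i) *
    sigma (coord_at theta (d * h + i) +
           \sum_(j < d) coord_at theta (i * d + j) * x 0 j).

Definition inf_risk (R : realType) (d : nat)
    (L : forall h : nat, 'rV[R]_(nparam d h) -> R) (h : nat) : R :=
  inf (range (L h)).

Definition critical_width (R : realType) (d : nat)
    (L : forall h : nat, 'rV[R]_(nparam d h) -> R) : \bar R :=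
  ereal_inf ([set (h%:R : R)%:E | h in [set h : nat | inf_risk L h = 0]]
             `|` [set +oo%E]).

Definition is_local_min (R : realType) (T : topologicalType) (F : T -> R)
  (t : T) : Prop := \forall u \near t, F t <= F u.

(* Main.v *)
(* A global minimiser of width h <= H becomes a local minimum of width H by
   adding neurons with bias -1 and no inner weights: they stay inactive on the
   compact cube when the parameters are perturbed slightly, so that near this
   point the risk of width H only takes values of the risk of width h.

   It remains to see that the optimal risks decrease strictly until they vanish.
   If no additional neuron improves on a network with residual g, then the first
   variation in the outer weight shows that g is orthogonal to all the neurons
   x |-> sigma (<w, x> + t). The functions of <w, x> + t orthogonal to g form a
   space closed under affine substitutions and bounded pointwise limits, which
   therefore contains the Heaviside function (by finite differences and
   rescaling), hence the exponential function (by staircase approximation). The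
   functions exp (<w, x> + t) span an algebra, so that exp (- u) is orthogonal
   to g for all sums u of such functions; letting
   u = \sum_j exp (n (n (x_j - t_j) + 1)) and n go to infinity gives the
   indicators of the boxes {x | forall j, x_j < t_j}. These boxes generate the
   Borel sets, so g = 0 almost everywhere and the risk vanishes. *)

Require Import Defs.
From HB Require Import structures.
From mathcomp Require Import all_boot all_order all_algebra.
From mathcomp Require Import all_classical all_reals all_analysis.
From mathcomp Require Import measurable_realfun ring lra.

Import Order.TTheory GRing.Theory Num.Theory.
Import numFieldNormedType.Exports.

Local Open Scope classical_set_scope.
Local Open Scope ring_scope.

(** * Functions orthogonal to a bounded function *)

Section orthogonality.
Context {R : realType} {d : measure_display} {T : measurableType d}
  (mu : {measure set T -> \bar R}) (g : T -> R).
Hypotheses (mufin : (mu setT < +oo)%E) (mg : measurable_fun setT g)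
  (bg : exists M : R, forall x, `|g x| <= M).

(** Measurability and boundedness belong to the notion: over a finite measure they make the product
    with [g] integrable, so that sums can be taken under the integral. *)
Definition orth (u : T -> R) : Prop :=
  [/\ measurable_fun setT u, exists M, forall x, `|u x| <= M &
      (\int[mu]_x (u x * g x)%:E = 0)%E].

Lemma bounded_integrable (u : T -> R) : measurable_fun setT u ->
  (exists M, forall x, `|u x| <= M) -> mu.-integrable setT (EFin \o u).
Proof.
move=> mu_ [M uM]; apply: measurable_bounded_integrable => //.
exists M; split; first exact: num_real.
by move=> N MN x _ /=; apply: (le_trans (uM x)); exact: ltW.
Qed.

Lemma bounded_mul (u v : T -> R) : (exists M, forall x, `|u x| <= M) ->
  (exists M, forall x, `|v x| <= M) -> exists M, forall x, `|u x * v x| <= M.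
Proof.
move=> [M uM] [N vN]; exists (M * N) => x; rewrite normrM.
by apply: ler_pM.
Qed.

Lemma orth_integrable (u : T -> R) : measurable_fun setT u ->
  (exists M, forall x, `|u x| <= M) ->
  mu.-integrable setT (fun x => (u x * g x)%:E).
Proof.
move=> mu_ bu; apply: bounded_integrable; first exact: measurable_funM.
exact: bounded_mul.
Qed.

Lemma orth0 : orth (fun=> 0).
Proof.
split; first exact: measurable_cst.
  by exists 0 => x; rewrite normr0.
by rewrite integral0_eq// => x _; rewrite mul0r.
Qed.

Lemma orthD u v : orth u -> orth v -> orth (fun x => u x + v x).
Proof.
move=> [mu_ bu u0] [mv bv v0]; split; first exact: measurable_funD.
  by case: bu bv => M uM [N vN]; exists (M + N) => x;
    exact: le_trans (ler_normD _ _) (lerD (uM x) (vN x)).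
under eq_integral do rewrite mulrDl EFinD.
by rewrite integralD ?u0 ?v0 ?adde0//; exact: orth_integrable.
Qed.

Lemma orthZ (r : R) u : orth u -> orth (fun x => r * u x).
Proof.
move=> [mu_ bu u0]; split; first exact: measurable_funM.
  by apply: bounded_mul => //; exists `|r|.
under eq_integral do rewrite -mulrA EFinM.
by rewrite integralZl ?u0 ?mule0//; exact: orth_integrable.
Qed.

Lemma orth_sum (I : Type) (s : seq I) (u : I -> T -> R) :
  (forall i, orth (u i)) -> orth (fun x => \sum_(i <- s) u i x).
Proof.
move=> ou; elim: s => [|i s IHs].
  by under eq_fun do rewrite big_nil; exact: orth0.
by under eq_fun do rewrite big_cons; exact: orthD.
Qed.

(** Dominated convergence: the products are bounded by [M * N], with [N] a bound of [g], and
    constants are integrable because the measure is finite. *)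
Lemma orth_lim (u : nat -> T -> R) (v : T -> R) (M : R) :
  (forall n, orth (u n)) -> (forall n x, `|u n x| <= M) ->
  (forall x, u ^~ x @ \oo --> v x) -> orth v.
Proof.
move=> ou uM uv.
have mv : measurable_fun setT v.
  apply: (@measurable_fun_cvg _ _ _ _ u) => //.
  by move=> n; case: (ou n).
have vM x : `|v x| <= M.
  have: `|u n x| @[n --> \oo] --> `|v x| by apply: cvg_norm; exact: uv.
  move=> /cvgP => cv.
  rewrite -(cvg_lim (@Rhausdorff R) (cvg_norm (uv x)))//.
  apply: limr_le => //.
  by apply: nearW => n; exact: uM.
split=> //; first by exists M.
case: bg => N gN.
have mug n : measurable_fun setT (fun x => (u n x * g x)%:E).
  by apply/measurable_EFinP/measurable_funM => //; case: (ou n).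
have mvg : measurable_fun setT (fun x => (v x * g x)%:E).
  exact/measurable_EFinP/measurable_funM.
have ug_cvg x : setT x -> (u n x * g x)%:E @[n --> \oo] --> (v x * g x)%:E.
  move=> _; apply: cvg_EFin; first exact: nearW.
  by apply: cvgMl; exact: uv.
have iMN : mu.-integrable setT (fun=> (M * N)%:E).
  by apply: bounded_integrable => //; exists `|M * N|.
have ugMN x n : setT x -> (`|(u n x * g x)%:E| <= (M * N)%:E)%E.
  by move=> _; rewrite lee_fin normrM; apply: ler_pM.
have [_ _] := dominated_convergence measurableT mug mvg (aeW mu ug_cvg) iMN
  (aeW mu (fun x n => ugMN x n)).
rewrite (_ : (fun n => _) = cst 0%E); last first.
  by apply/funext => n; case: (ou n).
by move=> L; rewrite -(cvg_lim _ L)// lim_cst.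
Qed.

End orthogonality.

(** * Ridge functions *)

(** Taylor's formula at [t] with increment -1 gives [q]. Its coefficient of index [n] is [n.+1]
    times the leading coefficient of [p], hence nonzero. *)
Lemma backward_difference {R : realType} (p : {poly R}) (n : nat) :
  size p = n.+2 ->
  exists2 q : {poly R}, size q = n.+1 &
    forall t, q.[t] = p.[t] - p.[t - 1].
Proof.
move=> sp.
exists (\sum_(i < n.+1) (- (-1) ^+ i.+1) *: p^`N(i.+1)); last first.
  move=> t; rewrite nderiv_taylor; last exact: mulrC.
  rewrite sp [in RHS]big_ord_recl /= nderivn0 expr0 mulr1 opprD addrA subrr add0r.
  rewrite horner_sum -sumrN; apply: eq_bigr => i _.
  by rewrite hornerZ mulNr mulrC.
have coefE j : (\sum_(i < n.+1) (- (-1) ^+ i.+1) *: p^`N(i.+1))`_j =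
    \sum_(i < n.+1) - (-1) ^+ i.+1 * (p`_(i.+1 + j) *+ 'C(i.+1 + j, i.+1)).
  by rewrite coef_sum; apply: eq_bigr => i _; rewrite coefZ coef_nderivn.
have p0 j : (n.+1 < j)%N -> p`_j = 0 by move=> nj; rewrite nth_default// sp.
apply/eqP; rewrite eqn_leq; apply/andP; split.
  apply/leq_sizeP => j nj; rewrite coefE big1// => i _.
  by rewrite p0 ?mul0rn ?mulr0// addSn ltnS (leq_trans nj)// leq_addl.
rewrite ltnNge; apply/negP => /leq_sizeP/(_ n (leqnn n))/eqP.
rewrite coefE big_ord_recl big1 => [|i _].
  rewrite addr0 expr1 opprK mul1r add1n bin1 mulrn_eq0/=.
  have := lead_coef_eq0 p; rewrite lead_coefE sp => ->.
  by rewrite -size_poly_eq0 sp.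
by rewrite p0 ?mul0rn ?mulr0// lift0 !addSn !ltnS leq_addl.
Qed.

Section ridge.
Context {R : realType} {d : measure_display} {T : measurableType d}
  (mu : {measure set T -> \bar R}) (g : T -> R).
Hypotheses (mufin : (mu setT < +oo)%E) (mg : measurable_fun setT g)
  (bg : exists M : R, forall x, `|g x| <= M).
Context (m : nat) (X : 'I_m -> T -> R) (D : R).
Hypotheses (mX : forall j, measurable_fun setT (X j))
  (bX : forall j x, `|X j x| <= D).

Definition aff (w : 'I_m -> R) (b : R) (x : T) : R :=
  b + \sum_(j < m) w j * X j x.

Lemma aff_bounded w b : exists M, forall x, `|aff w b x| <= M.
Proof.
exists (`|b| + \sum_(j < m) `|w j| * D) => x.
apply: (le_trans (ler_normD _ _)); rewrite lerD2l.
apply: (le_trans (ler_norm_sum _ _ _)); apply: ler_sum => j _.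
by rewrite normrM ler_wpM2l.
Qed.

Lemma measurable_aff w b : measurable_fun setT (aff w b).
Proof.
apply: measurable_funD; first exact: measurable_cst.
by apply: measurable_sum => j; apply: measurable_funM => //.
Qed.

Definition ridge (phi : R -> R) : Prop :=
  forall w b, orth mu g (fun x => phi (aff w b x)).

Definition locally_bounded (phi : R -> R) : Prop :=
  forall M, exists B, forall t, `|t| <= M -> `|phi t| <= B.

Lemma ridge_affine phi (r s : R) :
  ridge phi -> ridge (fun t => phi (r * t + s)).
Proof.
move=> rphi w b; have := rphi (fun j => r * w j) (r * b + s).
congr orth; apply/funext => x; congr phi; rewrite /aff mulrDr mulr_sumr.
by rewrite addrAC; congr (_ + _ + _); apply: eq_bigr => j _; rewrite mulrA.
Qed.

(** Each [aff w b] has bounded range, so bounds on bounded intervals, uniform in [n], suffice for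
    dominated convergence. *)
Lemma ridge_lim (phi : nat -> R -> R) (psi : R -> R) :
  (forall n, ridge (phi n)) ->
  (forall M, exists B, forall n t, `|t| <= M -> `|phi n t| <= B) ->
  (forall t, phi ^~ t @ \oo --> psi t) -> ridge psi.
Proof.
move=> rphi bphi cphi w b; have [M affM] := aff_bounded w b.
have [B phiB] := bphi M.
apply: (@orth_lim _ _ _ mu g mufin mg bg
  (fun n x => phi n (aff w b x)) _ B) => [n|n x|x].
- exact: rphi.
- exact: phiB.
- exact: cphi.
Qed.

(** The value at 0 is 0, like that of the functions rescaled in [ridge_heaviside], so that their
    limit is right at 0 too. *)
Definition heaviside (t : R) : R := (0 < t)%R%:R.

(* Each backward difference lowers by one the degree of the polynomial [p]
   with which [phi] eventually agrees; once it is constant, [phi (n t)]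
   converges to a multiple of the Heaviside function. *)
Lemma ridge_heaviside (n : nat) (p : {poly R}) (phi : R -> R) (S : R) :
  size p = n.+1 -> 0 <= S -> locally_bounded phi ->
  (forall t, t <= 0 -> phi t = 0) -> (forall t, S <= t -> phi t = p.[t]) ->
  ridge phi -> ridge heaviside.
Proof.
elim: n p phi S => [|n IHn] p phi S sp S0 bphi phi0 phip rphi.
  have /eqP/size_poly1P[c c0 pE] := sp; rewrite {p sp}pE in phip.
  have phic t : S <= t -> phi t = c by move=> /phip; rewrite hornerC.
  have [B phiB] := bphi S.
  (* Rescaled copies are evaluated arbitrarily far out, which calls for a global bound: [phi] is 0
     on the left, [c] from [S] on, and locally bounded in between. *)
  have phi_bounded t : `|phi t| <= B + `|c|.
    have B0 : 0 <= B by apply: le_trans (phiB 0 _); rewrite ?normr0.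
    have [t0|t0] := leP t 0; first by rewrite phi0// normr0 addr_ge0.
    have [St|tS] := leP S t; first by rewrite phic// lerDr.
    by rewrite (le_trans (phiB t _)) ?lerDl// ger0_norm ltW.
  apply: (@ridge_lim (fun n t => c^-1 * phi (n%:R * t + 0))).
  - by move=> k w b; apply: orthZ => //; exact: ridge_affine.
  - move=> M; exists (`|c^-1| * (B + `|c|)) => k t _.
    by rewrite normrM ler_wpM2l.
  - move=> t; have [t0|t0] := leP t 0.
      rewrite /heaviside ltNge t0/=.
      apply: cvg_near_cst; apply: nearW => k.
      by rewrite phi0 ?mulr0// addr0 mulr_ge0_le0.
    rewrite /heaviside t0/=; apply: cvg_near_cst.
    near=> k; rewrite phic ?mulVf// addr0 -ler_pdivrMr//.
    by near: k; exact: nbhs_infty_ger.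
have [q sq qE] := backward_difference _ _ sp.
(* The shifted copy is known to agree with the polynomial only from [S + 1] on. *)
apply: (IHn q (fun t => phi t - phi (t - 1)) (S + 1)) => //.
- by rewrite addr_ge0.
- move=> M; have [B phiB] := bphi (M + 1); exists (B + B) => t tM.
  apply: (le_trans (ler_normB _ _)); apply: lerD; apply: phiB.
    by rewrite (le_trans tM)// lerDl.
  by rewrite (le_trans (ler_normB _ _))// normr1 lerD2r.
- by move=> t t0; rewrite !phi0 ?subrr// (le_trans _ t0)// gerBl.
- move=> t St; rewrite qE !phip//; first by rewrite lerBrDr.
  by rewrite (le_trans _ St)// lerDl.
- move=> w b; apply: orthD => //.
  have := orthZ mu g mufin mg bg (-1) _ (ridge_affine phi 1 (-1) rphi w b).
  by congr orth; apply/funext => x; rewrite mul1r mulN1r.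
Unshelve. all: by end_near.
Qed.

End ridge.

(** * From the Heaviside function to exponentials *)

Section staircase.
Context {R : realType} (F : R -> R) (s delta : R).
Hypotheses (ndF : {homo F : x y / x <= y}) (delta0 : 0 <= delta).

Definition staircase (K : nat) (t : R) : R :=
  F s + \sum_(i < K) (F (s + i.+1%:R * delta) - F (s + i%:R * delta)) *
    heaviside (t - (s + i%:R * delta)).

(** The jumps telescope to the value of [F] at the right end of the step containing [t], a point
    between [t] and [t + delta]. *)
Lemma staircaseE K t : if t <= s then staircase K t = F s
  else if t <= s + K%:R * delta then is_true (F t <= staircase K t <= F (t + delta))
  else staircase K t = F (s + K%:R * delta).
Proof.
elim: K => [|K].
  rewrite /staircase big_ord0 addr0 mul0r addr0.
  by case: leP.
have -> : staircase K.+1 t = staircase K t +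
    (F (s + K.+1%:R * delta) - F (s + K%:R * delta)) *
    heaviside (t - (s + K%:R * delta)).
  by rewrite /staircase big_ord_recr/= addrA.
rewrite /heaviside subr_gt0.
have sK k : s <= s + k%:R * delta by rewrite lerDl mulr_ge0.
case: (leP t s) => [ts ->|st].
  by rewrite ltNge (le_trans ts (sK _)) mulr0 addr0.
have KS : s + K.+1%:R * delta = s + K%:R * delta + delta.
  by rewrite -natr1 mulrDl mul1r addrA.
case: (leP t (s + K%:R * delta)) => [tK IH|Kt ->].
  rewrite mulr0 addr0 ifT//.
  by rewrite KS (le_trans tK)// lerDl.
rewrite mulr1 [F _ + (_ - _)]addrC subrK.
by case: leP => // tK; rewrite !ndF// KS lerD2r ltW.
Qed.

End staircase.

Section exponentials.
Context {R : realType} {d : measure_display} {T : measurableType d}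
  (mu : {measure set T -> \bar R}) (g : T -> R).
Hypotheses (mufin : (mu setT < +oo)%E) (mg : measurable_fun setT g)
  (bg : exists M : R, forall x, `|g x| <= M).
Context (m : nat) (X : 'I_m -> T -> R) (D : R).
Hypothesis (bX : forall j x, `|X j x| <= D).
Hypothesis (rH : ridge mu g m X heaviside).

(** Dilation factor 0 and shift 1 turn the Heaviside function into the constant 1. *)
Lemma ridge_cst (c : R) : ridge mu g m X (fun=> c).
Proof.
move=> w b; have := orthZ mu g mufin mg bg c _
  (ridge_affine mu g m X heaviside 0 1 rH w b).
by congr orth; apply/funext => x; rewrite mul0r add0r /heaviside ltr01 mulr1.
Qed.

Lemma ridge_staircase (F : R -> R) (s delta : R) (K : nat) :
  ridge mu g m X (staircase F s delta K).
Proof.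
move=> w b; apply: orthD => //; first exact: ridge_cst.
apply: orth_sum => // i; apply: orthZ => //.
have := ridge_affine mu g m X heaviside 1 (- (s + i%:R * delta)) rH w b.
by congr orth; apply/funext => x; rewrite mul1r.
Qed.

Lemma ridge_expR : ridge mu g m X expR.
Proof.
pose N (n : nat) : R := n.+1%:R.
have N0 n : 0 < N n by rewrite /N ltr0n.
(* Mesh [1 / N] from [- N] to [N], which takes exactly [2 N ^ 2] steps. *)
pose phi n := staircase expR (- N n) (N n)^-1 (2 * n.+1 * n.+1).
have ndexp : {homo @expR R : x y / x <= y} by move=> x y; rewrite ler_expR.
have phiE n t : if t <= - N n then phi n t = expR (- N n)
    else if t <= N n then is_true (expR t <= phi n t <= expR (t + (N n)^-1))
    else phi n t = expR (N n).
  have := staircaseE expR (- N n) (N n)^-1 ndexp (ltW (_ : 0 < _))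
    (2 * n.+1 * n.+1) t.
  rewrite invr_gt0 => /(_ (N0 n)).
  have -> // : - N n + (2 * n.+1 * n.+1)%:R * (N n)^-1 = N n.
  by rewrite !natrM mulfK ?gt_eqF//; rewrite /N; ring.
apply: (@ridge_lim _ _ _ mu g mufin mg bg m X D bX phi).
- by move=> n; exact: ridge_staircase.
- move=> M; exists (1 + expR (M + 1)) => n t tM.
  have expN : expR (- N n) <= 1 by rewrite expR_le1 oppr_le0 ltW.
  have tM' : t <= M by rewrite (le_trans (ler_norm t)).
  have := phiE n t; case: leP => [_ ->|_].
    by rewrite ger0_norm ?expR_ge0// (le_trans expN)// lerDl expR_ge0.
  have invN : (N n)^-1 <= 1 by rewrite invf_le1// /N ler1n.
  case: leP => [_ /andP[h1 h2]|tN ->].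
    rewrite ger0_norm ?(le_trans _ h1) ?expR_ge0//.
    by rewrite (le_trans h2)// -[leLHS]add0r lerD// ler_expR lerD.
  rewrite ger0_norm ?expR_ge0// -[leLHS]add0r lerD// ler_expR.
  by rewrite (le_trans (ltW tN))// (le_trans tM')// lerDl.
- move=> t.
  have near_t : \forall n \near \oo, `|t| < N n.
    near=> n; apply: (@lt_le_trans _ _ n.+1%:R) => //.
    rewrite -natr1 ltr_pwDr//.
    by near: n; exact: nbhs_infty_ger.
  apply: (@squeeze_cvgr _ _ _ _ (fun=> expR t) (fun n => expR (t + (N n)^-1))).
  + near=> n; have : `|t| < N n by near: n.
    rewrite ltr_norml => /andP[Nt tN]; have := phiE n t.
    by rewrite leNgt Nt/= (ltW tN).
  + exact: cvg_cst.
  + have /continuous_cvg : {for t, continuous (@expR R)}.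
      exact: continuous_expR.
    apply; rewrite -[X in _ --> X]addr0; apply: cvgD; first exact: cvg_cst.
    exact: cvg_harmonic.
Unshelve. all: by end_near.
Qed.

(** Testing against all exponentials makes the induction on powers work: a further exponential
    factor is absorbed by the test exponential. *)
Definition exp_orth (u : T -> R) : Prop :=
  forall w b, orth mu g (fun x => u x * expR (aff m X w b x)).

Context (I : Type) (r : seq I) (w : I -> 'I_m -> R) (b : I -> R).

Let expsum x := \sum_(i <- r) expR (aff m X (w i) (b i) x).

Lemma exp_orth_expsumX k : exp_orth (fun x => expsum x ^+ k).
Proof.
elim: k => [|k IHk] v c.
  under eq_fun do rewrite expr0 mul1r.
  exact: ridge_expR.
under eq_fun do rewrite exprSr -mulrA mulr_suml mulr_sumr.
apply: orth_sum => // i.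
have := IHk (fun j => w i j + v j) (b i + c).
congr orth; apply/funext => x; congr (_ * _); rewrite -expRD; congr expR.
rewrite /aff addrACA -big_split/=; congr (_ + _).
by apply: eq_bigr => j _; rewrite mulrDl.
Qed.

(** The partial sums of the exponential series are polynomials in [expsum], bounded by [expR B] when
    [B] bounds [expsum]. *)
Lemma orth_expR_Nexpsum : orth mu g (fun x => expR (- expsum x)).
Proof.
have [B expsumB] : exists B, forall x, `|expsum x| <= B.
  have [_ [B expsumB] _] := exp_orth_expsumX 1 (fun=> 0) 0.
  exists B => x; have := expsumB x; rewrite expr1 /aff add0r.
  by rewrite big1 ?expR0 ?mulr1// => j _; rewrite mul0r.
apply: (@orth_lim _ _ _ mu g mufin mg bg
  (fun n x => series (exp_coeff (- expsum x)) n) _ (expR B)).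
- move=> n; rewrite /series/=; apply: orth_sum => // k.
  have := orthZ mu g mufin mg bg ((-1) ^+ k / k`!%:R) _
    (exp_orth_expsumX k (fun=> 0) 0).
  congr orth; apply/funext => x.
  rewrite /exp_coeff/= /aff add0r big1 ?expR0 ?mulr1; last first.
    by move=> j _; rewrite mul0r.
  by rewrite mulrAC -exprMn mulN1r.
- move=> n x; apply: (@le_trans _ _ (series (exp_coeff `|expsum x|) n)).
    rewrite /series/=; apply: (le_trans (ler_norm_sum _ _ _)).
    apply: ler_sum => k _; rewrite /exp_coeff/= normrM normrX normrN.
    by rewrite ger0_norm.
  apply: (@le_trans _ _ (expR `|expsum x|)); last by rewrite ler_expR.
  apply: nondecreasing_cvgn_le; last exact: is_cvg_series_exp_coeff.
  by apply: nondecreasing_series => k _ _; exact: exp_coeff_ge0.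
- move=> x; exact: is_cvg_series_exp_coeff.
Qed.

End exponentials.

(** * From exponentials to boxes *)

Section boxes.
Context {R : realType} {d : measure_display} {T : measurableType d}
  (mu : {measure set T -> \bar R}) (g : T -> R).
Hypotheses (mufin : (mu setT < +oo)%E) (mg : measurable_fun setT g)
  (bg : exists M : R, forall x, `|g x| <= M).
Context (m : nat) (X : 'I_m -> T -> R) (D : R).
Hypotheses (mX : forall j, measurable_fun setT (X j))
  (bX : forall j x, `|X j x| <= D).
Hypothesis (rH : ridge mu g m X heaviside).

Definition box (t : 'I_m -> R) : set T := [set x | forall j, X j x < t j].

(** The [j]-th exponent tends to minus infinity if [X j x < t j] and is at least [n] otherwise, the
    summand 1 deciding the boundary case [X j x = t j]. Hence [expR (- s n x)] tends to 1 in the box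
    and to 0 outside. *)
Lemma orth_box t : orth mu g \1_(box t).
Proof.
pose s (n : nat) x : R :=
  \sum_(j < m) expR (n%:R * (n%:R * (X j x - t j) + 1)).
apply: (@orth_lim _ _ _ mu g mufin mg bg (fun n x => expR (- s n x)) _ 1).
- move=> n.
  have := orth_expR_Nexpsum mu g mufin mg bg m X D bX rH 'I_m
    (index_enum 'I_m) (fun j i => n%:R * n%:R * (i == j)%:R)
    (fun j => n%:R * (1 - n%:R * t j)).
  congr orth; apply/funext => x; congr (expR (- _)).
  apply: eq_bigr => j _; congr expR; rewrite /aff (bigD1 j)//= eqxx mulr1n mulr1 big1.
    by ring.
  by move=> i /negbTE ->; rewrite mulr0 mul0r.
- move=> n x; rewrite ger0_norm ?expR_ge0// expR_le1 oppr_le0.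
  by apply: sumr_ge0 => j _; exact: expR_ge0.
- move=> x.
  have [tx|/existsNP[j /negP]] := pselect (box t x).
    rewrite indicE mem_set//= -[1%:R](expR0 R).
    have /continuous_cvg : {for (0 : R), continuous (@expR R)}.
      exact: continuous_expR.
    apply; rewrite -oppr0; apply: cvgN.
    rewrite [X in _ --> X](_ : _ = \sum_(j < m) (0 : R)); last by rewrite big1.
    apply: cvg_big => [|j _]; first exact: add_continuous.
    have txj : 0 < t j - X j x by rewrite subr_gt0.
    apply: (@squeeze_cvgr _ _ _ _ (fun=> 0) (fun n => expR (- n%:R))).
    + near=> n; rewrite expR_ge0/= ler_expR -mulrN1 ler_wpM2l//.
      (* From this [n] on, [n * (X j x - t j) + 1 <= - 1], so the exponent is at most [- n]. *)
      have : 2 / (t j - X j x) <= n%:R.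
        by near: n; exact: nbhs_infty_ger.
      by rewrite ler_pdivrMr//; lra.
    + exact: cvg_cst.
    + exact: cvgn_expR.
  rewrite -leNgt => tx.
  rewrite indicE memNset/=; last by move=> /(_ j); rewrite ltNge tx.
  apply: (@squeeze_cvgr _ _ _ _ (fun=> 0) (fun n => expR (- n%:R))).
  + near=> n; rewrite expR_ge0/= ler_expR lerN2.
    apply: (@le_trans _ _ (expR n%:R)).
      by apply: le_trans (expR_ge1Dx _); rewrite lerDr.
    rewrite /s (bigD1 j)//= -[leLHS]addr0; apply: lerD.
      rewrite ler_expR -[leLHS]mulr1 ler_wpM2l// lerDr mulr_ge0// subr_ge0//.
    by apply: sumr_ge0 => i _; exact: expR_ge0.
  + exact: cvg_cst.
  + exact: cvgn_expR.
Unshelve. all: by end_near.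
Qed.

Lemma measurable_box t : measurable (box t).
Proof.
rewrite (_ : box t = \bigcap_j (X j @^-1` `]-oo, t j[)); last first.
  apply/seteqP; split=> x /= bx j; first by move=> _; rewrite /= in_itv/=.
  by have := bx j Logic.I; rewrite /= in_itv.
apply: fin_bigcap_measurable => [|j _]; first exact: finite_finset.
by rewrite -[_ @^-1` _]setTI; exact: mX.
Qed.

(** The boxes are stable under intersection and the integral of [g] vanishes on each. Dynkin's
    theorem extends this to all measurable sets, so [g] is 0 almost everywhere. *)
Lemma orth_generating_boxes_integral_sqr :
  @measurable d T = <<s range box >> ->
  (\int[mu]_x (g x ^+ 2)%:E = 0)%E.
Proof.
move=> mE.
have ig A : measurable A -> mu.-integrable A (EFin \o g).
  move=> mA; apply: (integrableS measurableT) => //.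
  exact: bounded_integrable.
have Pbox : range box `<=` [set A | (\int[mu]_(x in A) (g x)%:E = 0)%E].
  move=> _ [t _ <-] /=; rewrite integral_mkcond.
  have [_ _ <-] := orth_box t; apply: eq_integral => x _.
  rewrite patchE indicE; case: (x \in box t); by rewrite ?mul1r ?mul0r.
have intT : (\int[mu]_x (g x)%:E = 0)%E.
  (* The coordinates are bounded by [D], so the whole space is a box; this is what complements
     require below. *)
  have : range box (box (fun=> D + 1)) by exists (fun=> D + 1).
  move=> /Pbox/=; rewrite (_ : box _ = setT)//.
  apply/seteqP; split=> // x _ j.
  rewrite (le_lt_trans (ler_norm _))// (le_lt_trans (bX j x))//.
  by rewrite ltrDl.
have P0 A : measurable A -> (\int[mu]_(x in A) (g x)%:E = 0)%E.
  move=> mA; have : <<s range box >> A by rewrite -mE.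
  move: A {mA}; apply: (dynkin_induction mE) => //.
  - move=> _ _ [s _ <-] [t _ <-]; exists (fun j => Num.min (s j) (t j)) => //.
    apply/seteqP; split=> x /=.
      by move=> st; split=> j; have := st j; rewrite lt_min => /andP[].
    by move=> [sx tx] j; rewrite lt_min sx tx.
  - move=> S mS S0; have := intT.
    rewrite -(setvU S) integral_setU//.
    + by rewrite S0 adde0.
    + exact: measurableC.
    + by apply/measurable_EFinP; rewrite setvU.
    + by apply/disj_setPS => x [].
  - move=> F mF tF F0; rewrite integral_bigcup//.
      by rewrite eseries0.
    by apply: ig; exact: bigcup_measurable.
have g0 : ae_eq mu setT (EFin \o g) (cst 0%E).
  apply: integral_ae_eq => //; first exact: ig.
  by move=> E _ mE'; rewrite P0// integral0.
rewrite (@ae_eq_integral _ _ _ mu _ (cst 0%E))//.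
- by rewrite integral0.
- by apply/measurable_EFinP; exact: measurable_funX.
- apply: filterS g0 => x /= gx xT; have := gx xT => -[->].
  by rewrite expr0n.
Qed.

End boxes.

(** * The Borel sets of the cube *)

(** Applied to two sigma-algebras on the cube: the Borel one and the one generated by the boxes. *)
Lemma measurable_fun_of_lt {d} {T : measurableType d} {R : realType}
    (X : T -> R) :
  (forall t, measurable [set x | X x < t]) -> measurable_fun setT X.
Proof.
move=> mX; apply: (measurability _ (RGenInftyO.measurableE R)).
move=> _ [_ [t ->] <-]; rewrite setTI.
suff <- : [set x | X x < t] = X @^-1` `]-oo, t[ by exact: mX.
by apply/seteqP; split=> x /=; rewrite in_itv.
Qed.

Section cube_borel.
Context {R : realType} {d : nat} {a b : R} (hab : a <= b).

Definition cube_coord (j : 'I_d) (x : borel_cube d hab) : R := cube_val x 0 j.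

Lemma cube_val_bounds (x : borel_cube d hab) j : a <= cube_val x 0 j <= b.
Proof. by case: x => x xC; have := set_mem xC; exact. Qed.

Lemma cube_coord_bounded j x : `|cube_coord j x| <= Num.max `|a| `|b|.
Proof.
have /andP[ax xb] := cube_val_bounds x j.
have hb := ler_norm b; have := ler_norm (- a); rewrite normrN => ha.
rewrite /cube_coord le_max; have [x0|x0] := ger0P (cube_val x 0 j).
  by apply/orP; right; lra.
by apply/orP; left; lra.
Qed.

Lemma measurable_cube_coord j : measurable_fun setT (cube_coord j).
Proof.
apply: measurable_fun_of_lt => t; apply: sub_sigma_algebra.
exists [set y : 'rV[R]_d | y 0 j < t] => //.
rewrite (_ : mkset _ = (fun y : 'rV[R]_d => y 0 j) @^-1` [set u | u < t])//.
apply: open_comp; last exact: open_lt.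
by move=> y _; exact: coord_continuous.
Qed.

Notation cube_box := (box d cube_coord).

Lemma box_measurable_cube_coord j r s :
  <<s range cube_box >> [set x | r < cube_coord j x < s].
Proof.
pose T' := g_sigma_algebraType (range cube_box).
have mlt t : @measurable _ T' [set x | cube_coord j x < t].
  apply: sub_sigma_algebra.
  (* The threshold [b + 1] does not constrain the other coordinates, which are at most [b]. *)
  exists (fun i => if i == j then t else b + 1) => //.
  apply/seteqP; split=> x /=; first by move=> /(_ j); rewrite eqxx.
  move=> xt i; case: eqP => [->//|_].
  by have /andP[_ /le_lt_trans] := cube_val_bounds x i; apply; rewrite ltrDl.
have mcoord := @measurable_fun_of_lt _ T' R _ mlt.
rewrite (_ : mkset _ = setT `&` cube_coord j @^-1` `]r, s[%classic).
  by apply: (mcoord measurableT); exact: measurable_itv.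
by rewrite setTI; apply/seteqP; split=> x /=; rewrite in_itv.
Qed.

(** Boxes are Borel since coordinates are measurable. Conversely, an open set is the countable union
    of those sup-norm balls with rational centre and radius [1 / (n + 1)] whose trace on the cube it
    contains. *)
Lemma borel_cube_generated_by_boxes :
  @measurable _ (borel_cube d hab) = <<s range cube_box >>.
Proof.
apply/seteqP; split; last first.
  apply: smallest_sub; first exact: sigma_algebra_measurable.
  by move=> _ [t _ <-]; apply: measurable_box => j; exact: measurable_cube_coord.
apply: smallest_sub; first exact: smallest_sigma_algebra.
move=> U [W oW WU].
pose T' := g_sigma_algebraType (range cube_box).
pose Q (i : 'rV[rat]_d * nat) : set (borel_cube d hab) :=
  [set x | forall j, ratr (i.1 0 j) - i.2.+1%:R^-1 < cube_coord j x <
                     ratr (i.1 0 j) + i.2.+1%:R^-1].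
pose F i : set (borel_cube d hab) := if `[< Q i `<=` U >] then Q i else set0.
suff -> : U = \bigcup_i F i.
  apply: (@countable_bigcupT_measurable _ T'); first exact: countableP.
  move=> i; rewrite /F; case: ifP => _; last exact: measurable0.
  rewrite (_ : Q i = \bigcap_j [set x | ratr (i.1 0 j) - i.2.+1%:R^-1 <
      cube_coord j x < ratr (i.1 0 j) + i.2.+1%:R^-1]); last first.
    by apply/seteqP; split=> x Qx j => [_|]; exact: Qx.
  apply: fin_bigcap_measurable => [|j _]; first exact: finite_finset.
  exact: box_measurable_cube_coord.
apply/seteqP; split=> x; last first.
  by move=> [i _]; rewrite /F; case: ifP => // /asboolP; apply.
rewrite -WU => Wx.
move: oW; rewrite openE => /(_ _ Wx) /nbhs_ballP[e /= e0 xeW].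
(* The factor 2 pays for two distances: from [x] to the rational centre and from there to any point
   of the ball. *)
have [n] : exists n : nat, n.+1%:R^-1 < e / 2.
  by have /ltr_add_invr[n] := divr_gt0 e0 (ltr0Sn R 1); rewrite add0r; exists n.
set r : R := n.+1%:R^-1 => re.
have r0 : 0 < r by rewrite invr_gt0.
have /choice[q qE] (j : 'I_d) : exists q : rat,
    cube_coord j x - r < ratr q < cube_coord j x + r.
  have : cube_coord j x - r < cube_coord j x + r by lra.
  by move=> /rat_in_itvoo[q]; rewrite in_itv/= => qj; exists q.
pose i : 'rV[rat]_d * nat := (\row_j q j, n).
have QiU : Q i `<=` U.
  move=> y Qy; rewrite -WU; apply: xeW; split=> // k j.
  have := Qy j; have := qE j; rewrite ord1 /= mxE -/r /cube_coord => h1 h2.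
  rewrite /ball/= ltr_norml; apply/andP; split; lra.
exists i => //; rewrite /F asboolT// => j; rewrite /= mxE -/r.
by have := qE j; lra.
Qed.

End cube_borel.

(** * Network parameters and activation *)

Section parameters.
Context {R : realType} {d : nat}.

(** The data are functions on [nat], so that networks of different widths can share them without
    casts between ordinals. *)
Definition mk_param (h : nat) (w : nat -> nat -> R) (b v : nat -> R) (c : R) :
    'rV[R]_(nparam d h) :=
  \row_m (if (m < d * h)%N then w (m %/ d)%N (m %% d)%N
          else if (m < d * h + h)%N then b (m - d * h)%N
          else if (m < d * h + 2 * h)%N then v (m - (d * h + h))%N
          else c).

Section coordinates.
Variables (h : nat) (w : nat -> nat -> R) (b v : nat -> R) (c : R).
Notation theta := (mk_param h w b v c).

Lemma mk_param_weight i (j : 'I_d) : (i < h)%N ->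
  coord_at theta (i * d + j) = w i j.
Proof.
move=> ih; have jd := ltn_ord j.
have lt_dh : (i * d + j < d * h)%N.
  apply: (@leq_trans (i.+1 * d)); first by rewrite mulSn addnC ltn_add2r.
  by rewrite [leqRHS]mulnC leq_mul2r ih orbT.
rewrite /coord_at mxE inordK; last first.
  by rewrite ltnS (leq_trans (ltnW lt_dh))// leq_addr.
rewrite lt_dh divnMDl ?(leq_ltn_trans _ jd)// divn_small// addn0.
by rewrite modnMDl modn_small.
Qed.

Lemma mk_param_bias i : (i < h)%N -> coord_at theta (d * h + i) = b i.
Proof.
move=> ih; rewrite /coord_at mxE inordK; last first.
  by rewrite ltnS leq_add2l (leq_trans (ltnW ih))// leq_pmull.
by rewrite ltnNge leq_addr/= ltn_add2l ih addKn.
Qed.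

Lemma mk_param_outer i : (i < h)%N -> coord_at theta (d * h + h + i) = v i.
Proof.
move=> ih.
have lt_2h : (d * h + h + i < d * h + 2 * h)%N.
  by rewrite -addnA ltn_add2l mul2n -addnn ltn_add2l.
rewrite /coord_at mxE inordK; last by rewrite ltnS ltnW.
by rewrite -addnA ltnNge leq_addr/= addnA ltnNge leq_addr/= lt_2h addKn.
Qed.

Lemma mk_param_cst : coord_at theta (d * h + 2 * h) = c.
Proof.
rewrite /coord_at mxE inordK// ltnNge leq_addr/= ltnNge leq_add2l.
by rewrite leq_pmull//= ltnn.
Qed.

Lemma network_mk_param (sigma : R -> R) (x : 'rV[R]_d) :
  network sigma theta x =
    c + \sum_(i < h) v i * sigma (b i + \sum_(j < d) w i j * x 0 j).
Proof.
rewrite /network mk_param_cst; congr (_ + _); apply: eq_bigr => i _.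
rewrite mk_param_outer// mk_param_bias//; congr (_ * sigma (_ + _)).
by apply: eq_bigr => j _; rewrite mk_param_weight.
Qed.

End coordinates.

(* The first [h] neurons are those of [theta], all others have inner weights
   [w], bias [b] and outer weight [v]. *)
Definition extend (h H : nat) (theta : 'rV[R]_(nparam d h))
    (w : nat -> R) (b v : R) : 'rV[R]_(nparam d H) :=
  mk_param H
    (fun i j => if (i < h)%N then coord_at theta (i * d + j) else w j)
    (fun i => if (i < h)%N then coord_at theta (d * h + i) else b)
    (fun i => if (i < h)%N then coord_at theta (d * h + h + i) else v)
    (coord_at theta (d * h + 2 * h)).

(** The added neurons are identical, hence the multiple [H - h]. This serves both for the inactive
    neurons of the local minima and for the single arbitrary neuron in the variation of the risk. *)
Lemma network_extend sigma h H (theta : 'rV[R]_(nparam d h)) w b v x :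
  (h <= H)%N ->
  network sigma (extend h H theta w b v) x =
    network sigma theta x +
    (v * sigma (b + \sum_(j < d) w j * x 0 j)) *+ (H - h).
Proof.
move=> hH; rewrite network_mk_param /network -addrA; congr (_ + _).
pose F i := (if (i < h)%N then coord_at theta (d * h + h + i) else v) *
  sigma ((if (i < h)%N then coord_at theta (d * h + i) else b) +
    \sum_(j < d)
      (if (i < h)%N then coord_at theta (i * d + j) else w j) * x 0 j).
rewrite -(big_mkord xpredT F) (big_cat_nat (n := h))//=; congr (_ + _).
  by rewrite big_mkord; apply: eq_bigr => i _; rewrite /F ltn_ord.
rewrite -sumr_const_nat; apply: eq_big_nat => i /andP[hi _].
by rewrite /F ltnNge hi.
Qed.

Definition restrict_param (h H : nat) (theta : 'rV[R]_(nparam d H)) :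
    'rV[R]_(nparam d h) :=
  mk_param h (fun i j => coord_at theta (i * d + j))
    (fun i => coord_at theta (d * H + i))
    (fun i => coord_at theta (d * H + H + i))
    (coord_at theta (d * H + 2 * H)).

Lemma network_restrict sigma h H (theta : 'rV[R]_(nparam d H)) (x : 'rV[R]_d) :
  (h <= H)%N ->
  (forall i, (h <= i < H)%N -> sigma (coord_at theta (d * H + i) +
     \sum_(j < d) coord_at theta (i * d + j) * x 0 j) = 0) ->
  network sigma theta x = network sigma (restrict_param h H theta) x.
Proof.
move=> hH sigma0; rewrite network_mk_param /network; congr (_ + _).
pose F i := coord_at theta (d * H + H + i) *
  sigma (coord_at theta (d * H + i) +
    \sum_(j < d) coord_at theta (i * d + j) * x 0 j).
rewrite -(big_mkord xpredT F) (big_cat_nat (n := h))//= big_mkord.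
rewrite [X in _ + X]big1_seq ?addr0// => i.
by rewrite mem_index_iota /F => /sigma0 ->; rewrite mulr0.
Qed.

(* The neurons added in [extend] have bias [-1] and no inner weights, so their
   pre-activation stays negative on a neighbourhood of parameters. *)
Lemma near_extend_dead (h H : nat) (theta : 'rV[R]_(nparam d h)) (D v : R) :
  0 <= D ->
  \forall u \near (extend h H theta (fun=> 0) (-1) v : 'rV[R]_(nparam d H)),
    forall x : 'rV[R]_d, (forall j, `|x 0 j| <= D) ->
    forall i, (h <= i < H)%N ->
      coord_at u (d * H + i) + \sum_(j < d) coord_at u (i * d + j) * x 0 j <= 0.
Proof.
move=> D0.
(* Within distance [e] the bias is below [- 1 + e] and the weighted sum is at most [d * e * D];
   these bounds add up to 0. *)
pose e : R := (1 + d%:R * D)^-1.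
have e0 : 0 < e by rewrite invr_gt0 ltr_pwDl// mulr_ge0.
apply/nbhs_ballP; exists e => //= u [_ Eu] x xD i /andP[hi iH].
have ub m : `|coord_at (extend h H theta (fun=> 0) (-1) v) m -
    coord_at u m| < e by exact: (Eu 0 (inord m)).
have := ub (d * H + i)%N; rewrite mk_param_bias// ltnNge hi/= => bias.
have weight (j : 'I_d) : coord_at u (i * d + j) * x 0 j <= e * D.
  have := ub (i * d + j)%N; rewrite mk_param_weight// ltnNge hi/= sub0r normrN.
  move=> uj; rewrite (le_trans (ler_norm _))// normrM ler_pM//.
  exact: ltW.
have : \sum_(j < d) coord_at u (i * d + j) * x 0 j <= d%:R * (e * D).
  rewrite (le_trans (ler_sum _ (fun j _ => weight j)))//.
  by rewrite sumr_const card_ord mulr_natl.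
have : e * (1 + d%:R * D) = 1 by rewrite mulVf// gt_eqF// -invr_gt0.
move: bias; rewrite ltr_norml => /andP[]; lra.
Qed.

End parameters.

Section activation.
Context {R : realType} (k : nat) (c : \bar R) (sigma : R -> R).
Hypotheses (hk : (0 < k)%N) (hc : (0 < c)%E)
  (hsigma : forall x : R, (sigma x)%:E = (maxe (mine x%:E c) 0 ^+ k)%E).

Lemma activationE :
  (exists2 r : R, 0 < r & sigma = fun x => Num.max (Num.min x r) 0 ^+ k) \/
  sigma = (fun x => Num.max x 0 ^+ k).
Proof.
case: c hc hsigma => [r|_|]// => [r0|] sigmaE; [left; exists r => //|right];
  apply/funext => x; have := sigmaE x.
  by rewrite -EFin_min -EFin_max -EFin_expe => -[].
by rewrite miney -EFin_max -EFin_expe => -[].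
Qed.

Lemma activation_npos x : x <= 0 -> sigma x = 0.
Proof.
by move=> x0; case: activationE => [[r r0]|] ->; rewrite max_r ?ge_min ?x0//
  expr0n; case: k hk.
Qed.

(** A finite cap gives a positive constant, an infinite one the monomial of degree [k];
    [ridge_heaviside] treats both alike. *)
Lemma activation_eventually_poly : exists S (p : {poly R}),
  [/\ 0 <= S, p != 0 & forall x, S <= x -> sigma x = p.[x]].
Proof.
case: activationE => [[r r0]|] ->.
  exists r, (r ^+ k)%:P; split; [exact: ltW| |move=> x rx].
    by rewrite polyC_eq0 expf_neq0// gt_eqF.
  by rewrite hornerC min_r// max_l// ltW.
exists 0, 'X^k; split=> [//||x x0]; last by rewrite hornerXn max_l.
by rewrite -size_poly_eq0 size_polyXn.
Qed.

Lemma activation_norm_le x : `|sigma x| <= `|x| ^+ k.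
Proof.
case: activationE => [[r r0]|] ->; rewrite normrX lerXn2r ?nnegrE//;
  rewrite ger0_norm ?le_max ?lexx ?orbT// ge_max normr_ge0 andbT.
  by rewrite ge_min ler_norm.
exact: ler_norm.
Qed.

Lemma activation_locally_bounded : locally_bounded sigma.
Proof.
move=> M; exists (M ^+ k) => t tM.
by rewrite (le_trans (activation_norm_le t))// lerXn2r// nnegrE (le_trans _ tM).
Qed.

Lemma measurable_activation : measurable_fun setT sigma.
Proof.
case: activationE => [[r r0]|] ->; apply: measurable_funX;
  apply: measurable_maxr => //.
exact: measurable_minr.
Qed.

End activation.

(** * The risk *)

(** The quadratic in [v] attains its minimum 0 at [v = 0], where its derivative is [2 p]. *)
Lemma linear_coef_eq0 {R : realType} (p q : R) :
  (forall v : R, 0 <= v * p *+ 2 + v ^+ 2 * q) -> p = 0.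
Proof.
move=> pq; apply/eqP; rewrite -sqrf_eq0 eq_le sqr_ge0 andbT.
have q0 : 0 <= q.
  have := pq 1; have := pq (-1); rewrite sqrrN expr1n !mul1r mulN1r; lra.
have q1 : 0 < q + 1 by rewrite ltr_wpDl.
(* The minimiser would be [- p / q]; the denominator [q + 1] also covers [q = 0]. *)
have := pq (- p / (q + 1)).
have -> : - p / (q + 1) * p *+ 2 + (- p / (q + 1)) ^+ 2 * q =
    - (p ^+ 2 * ((q + 2) / (q + 1) ^+ 2)) by field; rewrite gt_eqF.
rewrite oppr_ge0 pmulr_lle0// divr_gt0 ?exprn_gt0//; lra.
Qed.

Section risk.
Context {R : realType} {d : nat} {a b : R} (hab : a <= b)
  (mu : {measure set (borel_cube d hab) -> \bar R}) (f : borel_cube d hab -> R).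
Hypotheses (fbounded : exists M : R, forall x, `|f x| <= M)
  (fmeas : measurable_fun [set: borel_cube d hab] f).
Context (k : nat) (c : \bar R) (sigma : R -> R).
Hypotheses (hk : (0 < k)%N) (hc : (0 < c)%E)
  (hsigma : forall x : R, (sigma x)%:E = (maxe (mine x%:E c) 0 ^+ k)%E).
Context (L : forall h : nat, 'rV[R]_(nparam d h) -> R).
Hypothesis hL : forall (h : nat) (theta : 'rV[R]_(nparam d h)),
  (L h theta)%:E =
  (\int[mu]_x ((network sigma theta (cube_val x) - f x) ^+ 2)%:E)%E.

Notation coords := (cube_coord hab).
Notation residual theta := (fun x => network sigma theta (cube_val x) - f x).

Lemma risk_ge0 h (theta : 'rV[R]_(nparam d h)) : 0 <= L h theta.
Proof.
by rewrite -lee_fin hL integral_ge0// => x _; rewrite lee_fin sqr_ge0.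
Qed.

Lemma inf_risk_le h (theta : 'rV[R]_(nparam d h)) : inf_risk L h <= L h theta.
Proof.
apply: ge_inf; last by exists theta.
by exists 0 => _ [t _ <-]; exact: risk_ge0.
Qed.

Definition cst_param (xi : R) : 'rV[R]_(nparam d 0) :=
  mk_param 0 (fun _ _ => 0) (fun=> 0) (fun=> 0) xi.

Lemma network_cst_param (xi : R) (x : 'rV[R]_d) :
  network sigma (cst_param xi) x = xi.
Proof. by rewrite network_mk_param big_ord0 addr0. Qed.

Lemma eq_risk h H (theta : 'rV[R]_(nparam d h)) (eta : 'rV[R]_(nparam d H)) :
  (forall x : borel_cube d hab,
    network sigma theta (cube_val x) = network sigma eta (cube_val x)) ->
  L h theta = L H eta.
Proof.
move=> E; apply: EFin_inj; rewrite !hL.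
by apply: eq_integral => x _; rewrite E.
Qed.

Lemma measurable_neuron w t :
  measurable_fun setT (fun x => sigma (aff d coords w t x)).
Proof.
apply: measurableT_comp; first exact: (measurable_activation k c).
by apply: measurable_aff => j; exact: measurable_cube_coord.
Qed.

Lemma neuron_bounded w t :
  exists M, forall x, `|sigma (aff d coords w t x)| <= M.
Proof.
have [M affM] := aff_bounded d coords _ (cube_coord_bounded hab) w t.
have [B sigmaB] := activation_locally_bounded k c sigma hc hsigma M.
by exists B => x; exact: sigmaB.
Qed.

Lemma measurable_residual h (theta : 'rV[R]_(nparam d h)) :
  measurable_fun setT (residual theta).
Proof.
apply: measurable_funB => //; apply: measurable_funD => //.
apply: measurable_sum => i; apply: measurable_funM => //.
exact: measurable_neuron.
Qed.

(** The constant network [M + 1] has residual at least 1 everywhere, so its real-valued risk bounds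
    the total mass. *)
Lemma mu_finite : (mu setT < +oo)%E.
Proof.
have [M fM] := fbounded.
apply: (@le_lt_trans _ _ (L 0%N (cst_param (M + 1)))%:E); last exact: ltry.
rewrite hL -[mu setT]mul1e -integral_cst//.
apply: ge0_le_integral => //.
- by apply/measurable_EFinP; apply: measurable_funX; exact: measurable_residual.
- move=> x _; rewrite network_cst_param lee_fin exprn_ege1//.
  by rewrite lerBrDr addrC lerD2r (le_trans (ler_norm _)).
Qed.

Lemma residual_bounded h (theta : 'rV[R]_(nparam d h)) :
  exists M, forall x, `|residual theta x| <= M.
Proof.
have [M fM] := fbounded.
have /choice[B sigmaB] (i : 'I_h) := neuron_bounded
  (fun j => coord_at theta (i * d + j)) (coord_at theta (d * h + i)).
exists (`|coord_at theta (d * h + 2 * h)| +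
  \sum_(i < h) `|coord_at theta (d * h + h + i)| * B i + M) => x.
rewrite (le_trans (ler_normB _ _))// lerD// (le_trans (ler_normD _ _))//.
rewrite lerD2l (le_trans (ler_norm_sum _ _ _))//; apply: ler_sum => i _.
by rewrite normrM; apply: ler_wpM2l => //; exact: sigmaB.
Qed.

(* The first variation of the risk in the outer weight of an additional
   neuron is twice the pairing of that neuron with the residual. *)
Lemma neuron_orth_residual h (theta : 'rV[R]_(nparam d h)) :
  (forall eta : 'rV[R]_(nparam d h.+1), L h theta <= L h.+1 eta) ->
  ridge mu (residual theta) d coords sigma.
Proof.
move=> min_theta w t; set g := residual theta.
pose s x := sigma (aff d coords w t x).
have [ms bs] : measurable_fun setT s /\ exists M, forall x, `|s x| <= M.
  by split; [exact: measurable_neuron|exact: neuron_bounded].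
have mg : measurable_fun setT g := measurable_residual h theta.
have bg := residual_bounded h theta.
have int_mul (u v : borel_cube d hab -> R) : measurable_fun setT u ->
    measurable_fun setT v ->
    (exists M, forall x, `|u x| <= M) -> (exists M, forall x, `|v x| <= M) ->
    mu.-integrable setT (EFin \o (fun x => u x * v x)).
  move=> mu_ mv bu bv; apply: bounded_integrable; first exact: mu_finite.
    exact: measurable_funM.
  exact: bounded_mul.
have isg := int_mul _ _ ms mg bs bg.
have iss := int_mul _ _ ms ms bs bs.
have igg := int_mul _ _ mg mg bg bg.
suff sg0 : \int[mu]_x (s x * g x) = 0.
  split=> //; have /fineK <- := integrable_fin_num measurableT isg.
  by rewrite -[fine _]/(\int[mu]_x (s x * g x)) sg0.
apply: (linear_coef_eq0 _ (\int[mu]_x (s x * s x))) => v.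
(* [extend] expects weights indexed by [nat], so [w] is continued by 0 beyond [d]. *)
pose w' n := oapp w 0 (insub n).
have := min_theta (extend h h.+1 theta w' t v).
have -> : L h theta = \int[mu]_x (g x * g x).
  by rewrite /Rintegral -[LHS]/(fine (L h theta)%:E) hL.
have -> : L h.+1 (extend h h.+1 theta w' t v) =
    \int[mu]_x (g x * g x + (v *+ 2 * (s x * g x) + v ^+ 2 * (s x * s x))).
  rewrite /Rintegral -[LHS]/(fine (L h.+1 (extend h h.+1 theta w' t v))%:E) hL.
  congr fine; apply: eq_integral => x _; congr EFin.
  rewrite network_extend// subSnn mulr1n.
  have -> : \sum_(j < d) w' j * cube_val x 0 j = \sum_(j < d) w j * coords j x.
    by apply: eq_bigr => j _; rewrite /w' valK.
  rewrite -[sigma _]/(s x) /g; ring.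
have iZ r u : mu.-integrable setT (EFin \o u) ->
    mu.-integrable setT (EFin \o (fun x => r * u x)).
  by move=> iu; apply: (integrableZl measurableT r iu).
rewrite RintegralD//; last first.
  by exact: (integrableD measurableT (iZ _ _ isg) (iZ _ _ iss)).
rewrite RintegralD//; [|exact: iZ|exact: iZ].
rewrite !RintegralZl// lerDl; congr (0 <= _ + _); ring.
Qed.

(** The activation vanishes on the negative axis and is eventually a nonzero polynomial, so
    orthogonality to the residual passes from the neurons to the Heaviside function and on to the
    boxes. *)
Lemma risk_eq0_of_stationary h (theta : 'rV[R]_(nparam d h)) :
  (forall eta : 'rV[R]_(nparam d h.+1), L h theta <= L h.+1 eta) ->
  L h theta = 0.
Proof.
move=> min_theta.
have mg := measurable_residual h theta.
have bg := residual_bounded h theta.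
have bX := @cube_coord_bounded R d a b hab.
have [S [p [S0 p0 sigmap]]] := activation_eventually_poly k c sigma hc hsigma.
have rH : ridge mu (residual theta) d coords heaviside.
  apply: (@ridge_heaviside _ _ _ mu _ mu_finite mg bg d coords _ bX
    (size p).-1 p sigma S) => //.
  - by rewrite prednK// lt0n size_poly_eq0.
  - exact: (activation_locally_bounded k c).
  - by move=> x; exact: (activation_npos k c).
  - exact: neuron_orth_residual.
apply: EFin_inj; rewrite hL.
apply: (@orth_generating_boxes_integral_sqr _ _ _ mu _ mu_finite mg bg
  d coords _ bX rH).
exact: borel_cube_generated_by_boxes.
Qed.

(** Otherwise no network of width [h.+1] improves on [theta], which forces its risk to be 0. *)
Lemma inf_risk_lt h (theta : 'rV[R]_(nparam d h)) :
  L h theta = inf_risk L h -> inf_risk L h != 0 ->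
  inf_risk L h.+1 < inf_risk L h.
Proof.
move=> thetaE I0; rewrite ltNge; apply/negP => II.
move/eqP: I0; apply; rewrite -thetaE; apply: risk_eq0_of_stationary => eta.
by rewrite thetaE (le_trans II)// inf_risk_le.
Qed.

Lemma risk_extend_dead h H (theta : 'rV[R]_(nparam d h)) : (h <= H)%N ->
  L H (extend h H theta (fun=> 0) (-1) 0) = L h theta.
Proof.
move=> hH; apply: eq_risk => x.
by rewrite network_extend// mul0r mul0rn addr0.
Qed.

(** Near the extended parameter the added neurons vanish on the cube whatever their outer weights,
    so the risk equals that of a restricted network, which is at least [inf_risk L h]. *)
Lemma local_min_extend h H (theta : 'rV[R]_(nparam d h)) : (h <= H)%N ->
  L h theta = inf_risk L h ->
  is_local_min (L H) (extend h H theta (fun=> 0) (-1) 0).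
Proof.
move=> hH thetaE; rewrite /is_local_min risk_extend_dead// thetaE.
pose D : R := Num.max `|a| `|b|.
have D0 : 0 <= D by rewrite le_max normr_ge0.
apply: filterS (near_extend_dead h H theta D 0 D0) => u dead.
rewrite (_ : L H u = L h (restrict_param h H u)) ?inf_risk_le//.
apply: eq_risk => x; apply: network_restrict => // i hi.
apply: (activation_npos k c) => //; apply: dead => // j.
exact: cube_coord_bounded.
Qed.

End risk.

(** * Local minima of width [H] from optimal narrower networks *)

Theorem corollary3p15 (R : realType) (d : nat) (hd : (0 < d)%N)
    (a b : R) (hab : a <= b)
    (mu : {measure set (borel_cube d hab) -> \bar R})
    (f : borel_cube d hab -> R)
    (fbounded : exists M : R, forall x, `|f x| <= M)
    (fmeas : measurable_fun [set: borel_cube d hab] f)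
    (k : nat) (hk : (0 < k)%N)
    (c : \bar R) (hc : (0 < c)%E)
    (sigma : R -> R)
    (hsigma : forall x : R,
      (sigma x)%:E = (maxe (mine x%:E c) 0 ^+ k)%E)
    (L : forall h : nat, 'rV[R]_(nparam d h) -> R)
    (hL : forall (h : nat) (theta : 'rV[R]_(nparam d h)),
      (L h theta)%:E =
      (\int[mu]_x ((network sigma theta (cube_val x) - f x) ^+ 2)%:E)%E)
    (H n : nat)
    (hn : (n%:R : R)%:E = mine (H%:R : R)%:E (critical_width L))
    (hmin : forall h : nat, (h <= n)%N ->
      exists theta : 'rV[R]_(nparam d h), L h theta = inf_risk L h) :
  exists vartheta : nat -> 'rV[R]_(nparam d H),
    [/\ forall h : nat, (h <= n)%N -> is_local_min (L H) (vartheta h),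
        ((L H (vartheta 0%N))%:E <=
         ereal_inf (range (fun xi : R =>
           \int[mu]_x (`|f x - xi| ^+ 2)%:E)))%E &
        forall h : nat, (h < n)%N ->
          L H (vartheta h.+1) < L H (vartheta h)].
Proof.
have nH : (n <= H)%N.
  have : ((n%:R : R)%:E <= (H%:R : R)%:E)%E by rewrite hn ge_min lexx.
  by rewrite lee_fin ler_nat.
(* [critical_width] is a lower bound of the widths with optimal risk 0, and [n] does not exceed
   it. *)
have I_neq0 h : (h < n)%N -> inf_risk L h != 0.
  move=> hltn; apply/eqP => I0.
  have : ((n%:R : R)%:E <= (h%:R : R)%:E)%E.
    rewrite hn ge_min; apply/orP; right; apply: ereal_inf_lbound.
    by left; exists h.
  by rewrite lee_fin ler_nat leqNgt hltn.
(* The bound on [h] moves under the existential, with default 0 for larger [h], so that choice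
   yields a total function. *)
have min_ex h : exists theta : 'rV[R]_(nparam d h),
    (h <= n)%N -> L h theta = inf_risk L h.
  have [hn'|nh] := leqP h n; last by exists 0.
  by have [theta thetaE] := hmin h hn'; exists theta.
pose theta h := sval (cid (min_ex h)).
have thetaE h : (h <= n)%N -> L h (theta h) = inf_risk L h.
  exact: (svalP (cid (min_ex h))).
pose vartheta h := extend h H (theta h) (fun=> 0) (-1) 0.
have varthetaE h : (h <= n)%N -> L H (vartheta h) = inf_risk L h.
  move=> hn'; rewrite (risk_extend_dead hab mu f sigma L hL) ?(leq_trans hn')//.
  exact: thetaE.
exists vartheta; split.
- move=> h hn'.
  apply: (local_min_extend hab mu f k c sigma hk hc hsigma L hL).
    exact: leq_trans hn' nH.
  exact: thetaE.
(* Each constant is a network of width 0, and [vartheta 0] attains the optimal risk of that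
   width. *)
- apply/ereal_infP => _ [xi _ <-].
  rewrite varthetaE//.
  apply: (@le_trans _ _ (L 0%N (cst_param xi))%:E).
    by rewrite lee_fin (inf_risk_le hab mu f sigma L hL).
  rewrite hL le_eqVlt; apply/orP; left; apply/eqP.
  apply: eq_integral => x _.
  by rewrite network_cst_param real_normK ?num_real// -sqrrN opprB.
- move=> h hltn; rewrite !varthetaE//; last exact: ltnW.
  apply: (inf_risk_lt hab mu f fbounded fmeas k c sigma hk hc hsigma L hL
    h (theta h)); last exact: I_neq0.
  by apply: thetaE; exact: ltnW.
Qed.
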